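(* Let $A\in\mathbb{C}^{p\times q}$ and $C\in\mathbb{C}^{n\times q}$, and let their quotient singular value decomposition (QSVD) be given, with block sizes $p_1,p_2,p_3$, $q_1,\dots,q_4$, $n_1,n_2,n_3$ and quotient singular values as described in the context. Then the Kronecker canonical form (KCF) of the $(2p+q+n)\times(2p+q+n)$ pencil $$\mathcal A-\lambda\mathcal B=\begin{bmatrix} 0 & A & 0 & 0 \\ A^* & 0 & 0 & 0 \\ 0 & 0 & I & 0 \\ 0 & 0 & 0 & I \end{bmatrix}-\lambda\begin{bmatrix} 0 & 0 & I & 0 \\ 0 & 0 & 0 & C^* \\ I & 0 & 0 & 0 \\ 0 & C & 0 & 0 \end{bmatrix}$$ (block rows and block columns of sizes $p,q,p,n$) consists of the following blocks: 1. a $q_1\times q_1$ zero block (corresponding to quotient singular pairs of the form $(0,0)$); 2. a series of $n_3$ blocks $N_1$ (corresponding to $(1,0)$ pairs); 3. a series of $p_2$ blocks $N_3$ (corresponding to $(1,0)$ pairs); 4. a series of $p_3+q_2$ blocks $J_2(0)$ (corresponding to $(0,1)$ pairs); 5. the blocks $J_1(\sqrt{\sigma_j})$, $J_1(-\sqrt{\sigma_j})$, $J_1(i\sqrt{\sigma_j})$, $J_1(-i\sqrt{\sigma_j})$ for $j=1,\dots,p_1$, where $\sigma_1,\dots,\sigma_{p_1}$ are the finite and nonzero quotient singular values of the matrix pair $(A,C)$.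
   Context: $I$ denotes an identity matrix of appropriate size, and $M^*$ is the Hermitian transpose of $M$. QSVD: for $A\in\mathbb{C}^{p\times q}$ and $C\in\mathbb{C}^{n\times q}$ there exist a nonsingular $Y\in\mathbb{C}^{q\times q}$ and unitary $U\in\mathbb{C}^{p\times p}$, $V\in\mathbb{C}^{n\times n}$ such that $$U^*AY=\begin{bmatrix} 0 & 0 & D_\alpha & 0 \\ 0 & 0 & 0 & I \\ 0 & 0 & 0 & 0 \end{bmatrix},\qquad V^*CY=\begin{bmatrix} 0 & I & 0 & 0 \\ 0 & 0 & D_\gamma & 0 \\ 0 & 0 & 0 & 0 \end{bmatrix},$$ where the column blocks of both matrices have sizes $q_1,q_2,q_3,q_4$, the row blocks of the first have sizes $p_1,p_2,p_3$, the row blocks of the second have sizes $n_1,n_2,n_3$, and $n_2=p_1=q_3$, $n_1=q_2$, $p_2=q_4$. Here $D_\alpha=\operatorname{diag}(\alpha_1,\dots,\alpha_{p_1})$ and $D_\gamma=\operatorname{diag}(\gamma_1,\dots,\gamma_{p_1})$ with $\alpha_j,\gamma_j>0$ and $\alpha_j^2+\gamma_j^2=1$. The $p_1$ pairs $(\alpha_j,\gamma_j)$ together with $q_2$ pairs $(0,1)$ and $q_4$ pairs $(1,0)$ are the nontrivial pairs; the remaining $q_1$ pairs $(0,0)$ are trivial. A nontrivial pair $(\alpha,\gamma)$ corresponds to the quotient singular value $\sigma=\alpha/\gamma$ ($\infty$ if $\gamma=0$); so the finite nonzero quotient singular values are $\sigma_j=\alpha_j/\gamma_j$, $j=1,\dots,p_1$.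 Blocks: $J_\delta(\zeta)$ denotes the $\delta\times\delta$ pencil $K-\lambda I$, where $K$ is the Jordan block with $\zeta$ on the diagonal and $1$ on the first superdiagonal; $N_\gamma$ denotes the $\gamma\times\gamma$ pencil $I-\lambda Z$, where $Z$ has ones on the first superdiagonal and zeros elsewhere. The Kronecker canonical form of a pencil $\mathcal A-\lambda\mathcal B$ with $\mathcal A,\mathcal B\in\mathbb{C}^{k\times\ell}$ is the block diagonal pencil (unique up to the order of its diagonal blocks) of the standard Kronecker form (zero block, singular blocks $L_\alpha$, $L_\beta^T$, blocks $N_\gamma$ for infinite eigenvalues, blocks $J_\delta(\zeta)$ for finite eigenvalues) that equals $\mathcal Y^*(\mathcal A-\lambda\mathcal B)\mathcal X$ for some nonsingular $\mathcal X,\mathcal Y$ independent of $\lambda$. ''The KCF consists of the following blocks'' means that there exist such nonsingular $\mathcal X,\mathcal Y$ for which $\mathcal Y^*(\mathcal A-\lambda\mathcal B)\mathcal X$ is block diagonal with exactly the listed blocks (counted with multiplicity) on its diagonal. The parenthetical ''corresponding to'' remarks are only interpretive. *)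

(* Defs.v *)
From HB Require Import structures.
From mathcomp Require Import all_boot all_order all_algebra.
From mathcomp Require Import spectral.
From mathcomp Require Import reals.
From mathcomp Require Import complex.

Set Implicit Arguments.
Unset Strict Implicit.
Unset Printing Implicit Defensive.

Import Order.TTheory GRing.Theory Num.Theory.

Local Open Scope ring_scope.
Local Open Scope complex_scope.
Local Open Scope sesquilinear_scope.

(* The pencil A - lambda B, as a matrix of polynomials in lambda = 'X. *)
Definition pencil (K : comNzRingType) m n (A B : 'M[K]_(m, n)) :
    'M[{poly K}]_(m, n) :=
  map_mx polyC A - 'X *: map_mx polyC B.

Definition superdiag_mx (K : comNzRingType) m n : 'M[K]_(m, n) :=
  \matrix_(i < m, j < n) (j == i.+1 :> nat)%:R.

Inductive kron_block (K : Type) : Type :=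
| KZero of nat & nat
| KL of nat
| KLT of nat
| KN of nat
| KJ of nat & K.

Arguments KZero {K} _ _.
Arguments KL {K} _.
Arguments KLT {K} _.
Arguments KN {K} _.

Definition block_rows K (b : kron_block K) : nat :=
  match b with
  | KZero m _ => m
  | KL a => a
  | KLT a => a.+1
  | KN g => g
  | KJ d _ => d
  end.

Definition block_cols K (b : kron_block K) : nat :=
  match b with
  | KZero _ n => n
  | KL a => a.+1
  | KLT a => a
  | KN g => g
  | KJ d _ => d
  end.

(* L_a is the a x (a + 1) pencil [0 I] - lambda [I 0]. *)
Definition block_pencil (K : comNzRingType) (b : kron_block K) :
    'M[{poly K}]_(block_rows b, block_cols b) :=
  match b with
  | KZero m n => 0
  | KL a => pencil (superdiag_mx K a a.+1) (pid_mx a)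
  | KLT a => (pencil (superdiag_mx K a a.+1) (pid_mx a))^T
  | KN g => pencil 1%:M (superdiag_mx K g g)
  | KJ d z => pencil (z%:M + superdiag_mx K d d) 1%:M
  end.

Definition kron_rows K (s : seq (kron_block K)) : nat :=
  foldr (fun b m => (block_rows b + m)%N) 0%N s.

Definition kron_cols K (s : seq (kron_block K)) : nat :=
  foldr (fun b n => (block_cols b + n)%N) 0%N s.

Fixpoint kron_diag (K : comNzRingType) (s : seq (kron_block K)) :
    'M[{poly K}]_(kron_rows s, kron_cols s) :=
  match s with
  | [::] => 0
  | b :: s' => block_mx (block_pencil b) 0 0 (kron_diag s')
  end.

(* The order of s is immaterial: reordering the blocks amounts to permuting the
   columns of X and Y. *)
Definition KCF_consists_of (K : numClosedFieldType) k l
    (P : 'M[{poly K}]_(k, l)) (s : seq (kron_block K)) : Prop :=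
  exists (ek : kron_rows s = k) (el : kron_cols s = l)
         (X : 'M[K]_l) (Y : 'M[K]_k),
    [/\ X \in unitmx, Y \in unitmx &
        map_mx polyC (Y ^t*) *m P *m map_mx polyC X
          = castmx (ek, el) (kron_diag s)].

Section QSVD.

Variable R : realType.

Definition real_diag m (d : 'I_m -> R) : 'M[R[i]]_m :=
  diag_mx (\row_(j < m) (d j)%:C).

(* The sizes q3 = n2 = p1, q4 = p2 and n1 = q2 are substituted throughout. *)
Definition qsvd_formA p1 p2 p3 q1 q2 (alpha : 'I_p1 -> R) :
    'M[R[i]]_(p1 + (p2 + p3), q1 + (q2 + (p1 + p2))) :=
  col_mx (row_mx 0 (row_mx 0 (row_mx (real_diag alpha) 0)))
 (col_mx (row_mx 0 (row_mx 0 (row_mx 0                 1%:M)))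
         (row_mx 0 (row_mx 0 (row_mx 0                 0)))).

Definition qsvd_formC p1 p2 q1 q2 n3 (gamma : 'I_p1 -> R) :
    'M[R[i]]_(q2 + (p1 + n3), q1 + (q2 + (p1 + p2))) :=
  col_mx (row_mx 0 (row_mx 1%:M (row_mx 0                 0)))
 (col_mx (row_mx 0 (row_mx 0    (row_mx (real_diag gamma) 0)))
         (row_mx 0 (row_mx 0    (row_mx 0                 0)))).

Record is_qsvd p q n (A : 'M[R[i]]_(p, q)) (C : 'M[R[i]]_(n, q))
    (p1 p2 p3 q1 q2 n3 : nat) (alpha gamma : 'I_p1 -> R)
    (U : 'M[R[i]]_p) (V : 'M[R[i]]_n) (Y : 'M[R[i]]_q) : Prop := IsQsvd {
  qsvd_p : (p1 + (p2 + p3))%N = p;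
  qsvd_q : (q1 + (q2 + (p1 + p2)))%N = q;
  qsvd_n : (q2 + (p1 + n3))%N = n;
  qsvd_U : U \is unitarymx;
  qsvd_V : V \is unitarymx;
  qsvd_Y : Y \in unitmx;
  qsvd_alpha_gt0 : forall j, 0 < alpha j;
  qsvd_gamma_gt0 : forall j, 0 < gamma j;
  qsvd_alpha_gamma : forall j, alpha j ^+ 2 + gamma j ^+ 2 = 1;
  qsvd_A : U ^t* *m A *m Y
    = castmx (qsvd_p, qsvd_q) (qsvd_formA p2 p3 q1 q2 alpha);
  qsvd_C : V ^t* *m C *m Y
    = castmx (qsvd_n, qsvd_q) (qsvd_formC p2 q1 q2 n3 gamma)
}.

(* The finite nonzero quotient singular values sigma_j = alpha_j / gamma_j. *)
Definition quotient_sv p1 (alpha gamma : 'I_p1 -> R) (j : 'I_p1) : R :=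
  alpha j / gamma j.

(* In the next two matrices the top-level 2 x 2 partition groups the four block
   rows and columns of sizes p, q, p, n as (p + q) + (p + n). *)
Definition augmentedA p q n (A : 'M[R[i]]_(p, q)) :
    'M[R[i]]_((p + q) + (p + n)) :=
  block_mx (block_mx 0 A (A ^t*) 0) 0
           0                        (block_mx 1%:M 0 0 1%:M).

Definition augmentedB p q n (C : 'M[R[i]]_(n, q)) :
    'M[R[i]]_((p + q) + (p + n)) :=
  block_mx 0                      (block_mx 1%:M 0 0 (C ^t*))
           (block_mx 1%:M 0 0 C)  0.

End QSVD.

(* Main.v *)
Require Import Defs.
From mathcomp Require Import all_boot all_order all_algebra.
From mathcomp Require Import spectral reals complex.
From mathcomp Require Import ring zify.

Set Implicit Arguments.
Unset Strict Implicit.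
Unset Printing Implicit Defensive.

Import Order.TTheory GRing.Theory Num.Theory.

Local Open Scope ring_scope.
Local Open Scope complex_scope.

(* Multiplying by diag(U, Y, U, V) on the right and by its conjugate transpose
   on the left replaces A and C by their QSVD forms.  All blocks are then zero
   or diagonal, so a permutation of rows and columns splits the pencil into
   copies of the blocks 0, N_1, N_3 and J_2(0), and into one 4 x 4 pencil for
   each pair (alpha_j, gamma_j).  The latter has four distinct eigenvalues, the
   solutions of lambda^4 = sigma_j^2, hence is diagonalizable. *)

(* Strict equivalence, with possibly rectangular transformations: invertibility
   forces the sizes to agree, so no cast is needed until the very end. *)
Definition pencil_equiv (K : fieldType) k l k' l'
    (P : 'M[{poly K}]_(k, l)) (Q : 'M[{poly K}]_(k', l')) : Prop :=
  exists (Y : 'M[K]_(k', k)) (Y' : 'M[K]_(k, k'))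
         (X : 'M[K]_(l, l')) (X' : 'M[K]_(l', l)),
    [/\ Y *m Y' = 1%:M /\ Y' *m Y = 1%:M, X *m X' = 1%:M /\ X' *m X = 1%:M
      & map_mx polyC Y *m P *m map_mx polyC X = Q].

(** * Strict equivalence: composition, direct sums, permutations *)

Section PencilEquiv.

Variable K : fieldType.

Lemma pencil_equiv_trans k l k' l' k'' l'' (P : 'M[{poly K}]_(k, l))
    (Q : 'M[{poly K}]_(k', l')) (S : 'M[{poly K}]_(k'', l'')) :
  pencil_equiv P Q -> pencil_equiv Q S -> pencil_equiv P S.
Proof.
move=> [Y [Y' [X [X' [[h1 h2] [h3 h4] <-]]]]].
move=> [Z [Z' [W [W' [[g1 g2] [g3 g4] <-]]]]].
exists (Z *m Y), (Y' *m Z'), (X *m W), (W' *m X'); split.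
- by split; [rewrite mulmxA -(mulmxA Z) h1 | rewrite mulmxA -(mulmxA Y') g2];
    rewrite mulmx1.
- by split; [rewrite mulmxA -(mulmxA X) g3 | rewrite mulmxA -(mulmxA W') h4];
    rewrite mulmx1.
- by rewrite !map_mxM /= !mulmxA.
Qed.

Lemma pencil_equiv_block k1 l1 k2 l2 k1' l1' k2' l2'
    (P1 : 'M[{poly K}]_(k1, l1)) (P2 : 'M[{poly K}]_(k2, l2))
    (Q1 : 'M[{poly K}]_(k1', l1')) (Q2 : 'M[{poly K}]_(k2', l2')) :
  pencil_equiv P1 Q1 -> pencil_equiv P2 Q2 ->
  pencil_equiv (block_mx P1 0 0 P2) (block_mx Q1 0 0 Q2).
Proof.
move=> [Y [Y' [X [X' [[h1 h2] [h3 h4] <-]]]]].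
move=> [Z [Z' [W [W' [[g1 g2] [g3 g4] <-]]]]].
exists (block_mx Y 0 0 Z), (block_mx Y' 0 0 Z').
exists (block_mx X 0 0 W), (block_mx X' 0 0 W'); split.
- by split; rewrite mulmx_block !(mulmx0, mul0mx, addr0, add0r)
    ?(h1, h2) ?(g1, g2) -scalar_mx_block.
- by split; rewrite mulmx_block !(mulmx0, mul0mx, addr0, add0r)
    ?(h3, h4) ?(g3, g4) -scalar_mx_block.
- by rewrite !map_block_mx !map_mx0 !mulmx_block
    !(mulmx0, mul0mx, addr0, add0r).
Qed.

(** Selecting rows or columns of the identity along a bijection gives a permutation matrix, whose
    inverse selects along the inverse bijection. *)
Lemma pencil_equiv_bij k l k' l' (P : 'M[{poly K}]_(k, l))
    (Q : 'M[{poly K}]_(k', l')) (f : 'I_k' -> 'I_k) (g : 'I_l' -> 'I_l) :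
  bijective f -> bijective g -> (forall i j, Q i j = P (f i) (g j)) ->
  pencil_equiv P Q.
Proof.
move=> [f' fK f'K] [g' gK g'K] QE.
exists (rowsub f 1%:M), (rowsub f' 1%:M), (colsub g 1%:M), (colsub g' 1%:M).
have sub1 m n (h : 'I_m -> 'I_n) (h' : 'I_n -> 'I_m) : cancel h h' ->
    mxsub (h' \o h) id 1%:M = 1%:M :> 'M[K]_m.
  by move=> hK; rewrite mxsub_eq_id.
have sub1c m n (h : 'I_m -> 'I_n) (h' : 'I_n -> 'I_m) : cancel h h' ->
    mxsub id (h' \o h) 1%:M = 1%:M :> 'M[K]_m.
  by move=> hK; rewrite mxsub_eq_id.
split.
- by split; rewrite -rowsubE -rowsub_comp sub1.
- by split; rewrite mulmx_colsub mulmx1 -colsub_comp sub1c.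
- rewrite !map_mxsub !map_mx1 mul_rowsub_mx mulmx_colsub mul1mx mulmx1.
  by apply/matrixP=> i j; rewrite !mxE QE.
Qed.

Lemma pencil_equiv_refl k l (P : 'M[{poly K}]_(k, l)) : pencil_equiv P P.
Proof. by apply: (@pencil_equiv_bij _ _ _ _ _ _ id id) => //; exists id. Qed.

Lemma pencil_equiv_cast k l k' l' (e : (k = k') * (l = l'))
    (P : 'M[{poly K}]_(k, l)) : pencil_equiv P (castmx e P).
Proof.
by case: e => ek el; subst k' l'; rewrite castmx_id; apply: pencil_equiv_refl.
Qed.

Lemma kron_diag_cat (s t : seq (kron_block K)) :
  pencil_equiv (block_mx (kron_diag s) 0 0 (kron_diag t)) (kron_diag (s ++ t)).
Proof.
elim: s => [|b s IHs] /=.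
  (* The empty list contributes a 0 x 0 block, so every index is a right shift. *)
  apply: (@pencil_equiv_bij _ _ _ _ _ _ (@rshift 0 _) (@rshift 0 _)).
  - by apply: inj_card_bij; [apply: rshift_inj | rewrite !card_ord].
  - by apply: inj_card_bij; [apply: rshift_inj | rewrite !card_ord].
  - by move=> i j; rewrite block_mxEdr.
apply: (@pencil_equiv_trans _ _ _ _ _ _ _
  (block_mx (block_pencil b) 0 0 (block_mx (kron_diag s) 0 0 (kron_diag t)))).
  have := @block_mxA {poly K} _ _ _ _ _ _ (block_pencil b) 0 0 0 (kron_diag s)
    0 0 0 (kron_diag t).
  rewrite /= !row_mx0 !col_mx0 => ->.
  exact: pencil_equiv_cast.
by apply: pencil_equiv_block => //; apply: pencil_equiv_refl.
Qed.

End PencilEquiv.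

(** * Block decompositions of pencils indexed by finite types *)

Section HasKCF.

Variable K : fieldType.

Definition fin_mx (I J : finType) (P : I -> J -> {poly K}) :
    'M[{poly K}]_(#|I|, #|J|) :=
  \matrix_(i, j) P (enum_val i) (enum_val j).

(* Pencils indexed by arbitrary finite types make reorderings of rows and
   columns a matter of exhibiting bijections between index types. *)
Definition has_kcf (I J : finType) (P : I -> J -> {poly K})
    (s : seq (kron_block K)) : Prop :=
  pencil_equiv (fin_mx P) (kron_diag s).

Definition fin_sum (I1 J1 I2 J2 : finType) (P1 : I1 -> J1 -> {poly K})
    (P2 : I2 -> J2 -> {poly K}) (i : I1 + I2) (j : J1 + J2) : {poly K} :=
  match i, j with
  | inl i', inl j' => P1 i' j'
  | inr i', inr j' => P2 i' j'
  | _, _ => 0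
  end.

(** The summand may vary with its index, as is needed for the pairs (alpha_j, gamma_j). *)
Definition fin_copies m (I J : finType) (P : 'I_m -> I -> J -> {poly K})
    (i : 'I_m * I) (j : 'I_m * J) : {poly K} :=
  P i.1 i.2 j.2 *+ (i.1 == j.1).

Lemma has_kcf_bij (I J I' J' : finType) (P : I -> J -> {poly K})
    (Q : I' -> J' -> {poly K}) (f : I' -> I) (g : J' -> J) s :
  bijective f -> bijective g -> (forall i j, Q i j = P (f i) (g j)) ->
  has_kcf Q s -> has_kcf P s.
Proof.
move=> fB gB QE; apply: pencil_equiv_trans.
apply: (@pencil_equiv_bij _ _ _ _ _ _ _ (enum_rank \o f \o enum_val)
                                        (enum_rank \o g \o enum_val)).
- exact/bij_comp/enum_val_bij/bij_comp/fB/enum_rank_bij.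
- exact/bij_comp/enum_val_bij/bij_comp/gB/enum_rank_bij.
- by move=> i j; rewrite !mxE /= !enum_rankK.
Qed.

Lemma has_kcf_of_mx k l (M : 'M[{poly K}]_(k, l)) s :
  has_kcf (fun i j => M i j) s -> pencil_equiv M (kron_diag s).
Proof.
apply: pencil_equiv_trans.
apply: (@pencil_equiv_bij _ _ _ _ _ _ _ enum_val enum_val).
- exact: enum_val_bij.
- exact: enum_val_bij.
- by move=> i j; rewrite mxE.
Qed.

Lemma has_kcf_sum (I1 J1 I2 J2 : finType) (P1 : I1 -> J1 -> {poly K})
    (P2 : I2 -> J2 -> {poly K}) s1 s2 :
  has_kcf P1 s1 -> has_kcf P2 s2 -> has_kcf (fin_sum P1 P2) (s1 ++ s2).
Proof.
move=> h1 h2; apply: pencil_equiv_trans (kron_diag_cat _ _).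
apply: pencil_equiv_trans (pencil_equiv_block h1 h2).
(* No compatibility is assumed between the enumeration of a sum type and those of its summands; [r]
   translates one into the other. *)
pose r (I1 I2 : finType) (x : 'I_(#|I1| + #|I2|)) : 'I_#|{: I1 + I2}| :=
  enum_rank (match split x with
             | inl i => inl (enum_val i) | inr i => inr (enum_val i) end).
have rB (I1' I2' : finType) : bijective (@r I1' I2').
  pose r' (x : 'I_#|{: I1' + I2'}|) := unsplit
    (match enum_val x with
     | inl i => inl (enum_rank i) | inr i => inr (enum_rank i) end).
  exists r' => x.
    by rewrite /r' /r enum_rankK -[RHS]splitK; case: (split x) => i;
      rewrite enum_valK.
  rewrite /r' /r unsplitK -[RHS]enum_valK.
  by case: (enum_val x) => i; rewrite enum_rankK.
apply: (pencil_equiv_bij (rB _ _) (rB _ _)) => i j.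
rewrite [RHS]mxE /r !enum_rankK.
by rewrite -(splitK i) -(splitK j); case: (split i) (split j) => i' [] j';
  rewrite !unsplitK /=
    ?(block_mxEul, block_mxEur, block_mxEdl, block_mxEdr) ?mxE.
Qed.

Lemma has_kcf_mx (I J : finType) k l (M : 'M[{poly K}]_(k, l))
    (f : I -> 'I_k) (g : J -> 'I_l) s :
  bijective f -> bijective g -> pencil_equiv M (kron_diag s) ->
  has_kcf (fun i j => M (f i) (g j)) s.
Proof.
move=> [f' fK f'K] [g' gK g'K]; apply: pencil_equiv_trans.
apply: (@pencil_equiv_bij _ _ _ _ _ _ _ (enum_rank \o f') (enum_rank \o g')).
- by apply: bij_comp (enum_rank_bij _) _; exists f.
- by apply: bij_comp (enum_rank_bij _) _; exists g.
- by move=> i j; rewrite mxE !enum_rankK f'K g'K.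
Qed.

(** The two sides differ only by the trailing 0 x 0 block that ends every [kron_diag]. *)
Lemma block_pencil_equiv (b : kron_block K) :
  pencil_equiv (block_pencil b) (kron_diag [:: b]).
Proof.
apply: (@pencil_equiv_bij _ _ _ _ _ _ _ (cast_ord (addn0 _))
                                        (cast_ord (addn0 _))).
- by exists (cast_ord (esym (addn0 _))) => x; rewrite ?(cast_ordK, cast_ordKV).
- by exists (cast_ord (esym (addn0 _))) => x; rewrite ?(cast_ordK, cast_ordKV).
- move=> i j; case: (split_ordP i) => [i' ->|[]//].
  case: (split_ordP j) => [j' ->|[]//].
  by rewrite [LHS]block_mxEul; congr (block_pencil b _ _); apply: val_inj.
Qed.

(** Induction on [m]: the copy at [ord0] is split off as the left summand of a [fin_sum]. *)
Lemma has_kcf_copies m (I J : finType) (P : 'I_m -> I -> J -> {poly K}) s :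
  (forall k, has_kcf (P k) (s k)) ->
  has_kcf (fin_copies P) (flatten [seq s k | k <- enum 'I_m]).
Proof.
elim: m P s => [|m IHm] P s Ps.
  rewrite (size0nil (size_enum_ord 0)) /=.
  have c0 (T : finType) : #|{: 'I_0 * T}| = 0%N by rewrite card_prod card_ord.
  apply: (@pencil_equiv_bij _ _ _ _ _ _ _ (cast_ord (esym (c0 _)))
                                          (cast_ord (esym (c0 _)))).
  - by exists (cast_ord (c0 _)) => x; rewrite ?(cast_ordK, cast_ordKV).
  - by exists (cast_ord (c0 _)) => x; rewrite ?(cast_ordK, cast_ordKV).
  - by case.
rewrite enum_ordSl /= -map_comp.
pose c (T : finType) (x : T + 'I_m * T) : 'I_m.+1 * T :=
  match x with inl i => (ord0, i) | inr (k, i) => (lift ord0 k, i) end.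
have cB (T : finType) : bijective (@c T).
  exists (fun x => if unlift ord0 x.1 is Some k then inr (k, x.2) else inl x.2).
    by case=> [i|[k i]] /=; rewrite ?unlift_none ?liftK.
  by case=> k i /=; case: unliftP => [k'|] ->.
apply: has_kcf_bij (cB _) (cB _) _
  (has_kcf_sum (Ps ord0) (IHm _ _ (fun k => Ps (lift ord0 k)))).
by case=> [i|[k i]] [j|[k' j]]; rewrite /fin_copies /= ?(inj_eq lift_inj).
Qed.

End HasKCF.

(** * Diagonalization of the 4 x 4 pencil of one pair *)

Section FiniteBlock.

Variable K : fieldType.

Lemma mulmx_pencil k l k' l' (A B : 'M[K]_(k, l)) (Y : 'M[K]_(k', k))
    (X : 'M[K]_(l, l')) :
  map_mx polyC Y *m pencil A B *m map_mx polyC X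
    = pencil (Y *m A *m X) (Y *m B *m X).
Proof.
by rewrite /pencil mulmxBr mulmxBl -!scalemxAr -!scalemxAl !map_mxM.
Qed.

Lemma pencil_diag_equiv m (z : 'I_m -> K) :
  pencil_equiv (pencil (diag_mx (\row_j z j)) 1%:M)
               (kron_diag [seq KJ 1 (z j) | j <- enum 'I_m]).
Proof.
apply: has_kcf_of_mx.
have U : bijective (fun _ : unit => ord0 : 'I_1).
  by exists (fun=> tt) => [[]|x]; rewrite ?ord1.
have B : bijective (@fst 'I_m unit).
  by exists (fun i => (i, tt)) => [[i []]|i].
have kcf_j j := has_kcf_mx U U (block_pencil_equiv (KJ 1 (z j))).
have := has_kcf_copies kcf_j; rewrite flatten_map1.
apply: (has_kcf_bij B B) => -[i []] [j []].
rewrite /fin_copies /= !mxE /= mulr1n addr0.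
by case: eqP => [->|_]; rewrite ?(mulr1n, mulr0n, polyC0, mulr0, subr0).
Qed.

(* The 4 x 4 pencil to which one pair (alpha, gamma) contributes; its indices
   (false, false), (false, true), (true, false), (true, true) come from the
   blocks of sizes p, q, p, n, in this order. *)
Definition pair_entryA (alpha : K) (i j : bool * bool) : K :=
  match i, j with
  | (false, false), (false, true) | (false, true), (false, false) => alpha
  | (true, false), (true, false) | (true, true), (true, true) => 1
  | _, _ => 0
  end.

Definition pair_entryB (gamma : K) (i j : bool * bool) : K :=
  match i, j with
  | (false, false), (true, false) | (true, false), (false, false) => 1
  | (false, true), (true, true) | (true, true), (false, true) => gamma
  | _, _ => 0
  end.

(** The eigenvalues are the fourth roots of [r ^+ 4]. With [w] in place of the imaginary unit,
    everything reduces to rational identities modulo [w ^+ 2 = - 1]. *)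
Lemma has_kcf_pair (alpha gamma r w : K) :
    2 != 0 :> K -> gamma != 0 -> r != 0 -> r ^+ 2 = alpha / gamma ->
    w ^+ 2 = - 1 ->
  has_kcf (fun i j => (pair_entryA alpha i j)%:P
                      - 'X * (pair_entryB gamma i j)%:P)
    [:: KJ 1 r; KJ 1 (- r); KJ 1 (w * r); KJ 1 (- (w * r))].
Proof.
move=> two0 g0 r0 rE wE.
have w0 : w != 0.
  by apply: contra_eq_neq wE => ->; rewrite expr0n eq_sym oppr_eq0 oner_eq0.
have -> : alpha = r ^+ 2 * gamma by rewrite rE divfK.
(* Binary digits of [i], high bit first, so that 0, 1, 2, 3 follow the order p, q, p, n. *)
pose bb (i : 'I_4) : bool * bool := (1 < i, odd i)%N.
have bbB : bijective bb.
  apply: inj_card_bij; last by rewrite card_ord card_prod card_bool.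
  case=> [[|[|[|[|//]]]] ?] [[|[|[|[|//]]]] ?] //= _; exact: val_inj.
have [b4 bbK b4K] := bbB.
pose A := \matrix_(i, j) pair_entryA (r ^+ 2 * gamma) (bb i) (bb j).
pose B := \matrix_(i, j) pair_entryB gamma (bb i) (bb j).
suff AB : pencil_equiv (pencil A B)
    (kron_diag [:: KJ 1 r; KJ 1 (- r); KJ 1 (w * r); KJ 1 (- (w * r))]).
  have b4B : bijective b4 by exists bb.
  have idB : bijective (@id (bool * bool)) by exists id.
  apply: (has_kcf_bij idB idB _ (has_kcf_mx b4B b4B AB)) => i j.
  by rewrite !mxE !b4K.
pose z (j : 'I_4) := [:: r; - r; w * r; - (w * r)]`_j.
(* The sign [e j] is determined by [z j ^+ 2 = e j * r ^+ 2]. *)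
pose e (j : 'I_4) : K := [:: 1; 1; -1; -1]`_j.
have := @pencil_diag_equiv 4 z.
rewrite !enum_ordSl (size0nil (size_enum_ord 0)) /= /z /= -/z.
apply: pencil_equiv_trans.
(* [v j] is an eigenvector for the eigenvalue [z j]; as both coefficient
   matrices are symmetric, it is also a left eigenvector. *)
pose v j := [:: 1; e j / gamma; z j; e j * z j].
pose X : 'M[K]_4 := \matrix_(i, j) (v j)`_i.
(* The bilinear form of [B] takes the value [4 * z i] on the pair ([v i], [v i]); dividing by it
   normalizes [Y *m B *m X] to the identity. *)
pose Y : 'M[K]_4 := \matrix_(i, j) ((v i)`_j / (4 * z i)).
have four0 : 4 != 0 :> K by rewrite (natrM _ 2 2) mulf_neq0.
have YAX : Y *m A *m X = diag_mx (\row_j z j).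
  apply/matrixP => i j.
  rewrite !mxE !big_ord_recl big_ord0 !mxE !big_ord_recl !big_ord0 !mxE /=.
  case: i => [[|[|[|[|//]]]] ?]; case: j => [[|[|[|[|//]]]] ?];
    rewrite /v /z /e /= ?mulr1n ?mulr0n; field: wE;
    by rewrite ?(oppr_eq0, mulf_neq0, four0, r0, g0, w0).
have YBX : Y *m B *m X = 1%:M.
  apply/matrixP => i j.
  rewrite !mxE !big_ord_recl big_ord0 !mxE !big_ord_recl !big_ord0 !mxE /=.
  case: i => [[|[|[|[|//]]]] ?]; case: j => [[|[|[|[|//]]]] ?];
    rewrite /v /z /e /= ?mulr1n ?mulr0n; field: wE;
    by rewrite ?(oppr_eq0, mulf_neq0, four0, r0, g0, w0).
(* Regrouping the single identity [Y *m B *m X = 1%:M] provides the inverses of both [Y] and [X]. *)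
exists Y, (B *m X), X, (Y *m B); split.
- by rewrite mulmxA YBX; split=> //; apply: mulmx1C; rewrite mulmxA.
- by rewrite YBX; split=> //; apply: mulmx1C.
- by rewrite mulmx_pencil YAX YBX.
Qed.

End FiniteBlock.

(** * Splitting the pencil of the QSVD forms by permutations *)

Section ReducedPencil.

Local Open Scope sesquilinear_scope.

Variables (R : realType) (p1 p2 p3 q1 q2 n3 : nat) (alpha gamma : 'I_p1 -> R).

Let dim := (((p1 + (p2 + p3)) + (q1 + (q2 + (p1 + p2))))
           + ((p1 + (p2 + p3)) + (q2 + (p1 + n3))))%N.

(* The positions x, y, z, w of sizes p, q, p, n, split according to the QSVD. *)
Let x1 j : 'I_dim := lshift _ (lshift _ (lshift _ j)).
Let x2 j : 'I_dim := lshift _ (lshift _ (rshift _ (lshift _ j))).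
Let x3 j : 'I_dim := lshift _ (lshift _ (rshift _ (rshift _ j))).
Let y1 j : 'I_dim := lshift _ (rshift _ (lshift _ j)).
Let y2 j : 'I_dim := lshift _ (rshift _ (rshift _ (lshift _ j))).
Let y3 j : 'I_dim :=
  lshift _ (rshift _ (rshift _ (rshift _ (lshift _ j)))).
Let y4 j : 'I_dim :=
  lshift _ (rshift _ (rshift _ (rshift _ (rshift _ j)))).
Let z1 j : 'I_dim := rshift _ (lshift _ (lshift _ j)).
Let z2 j : 'I_dim := rshift _ (lshift _ (rshift _ (lshift _ j))).
Let z3 j : 'I_dim := rshift _ (lshift _ (rshift _ (rshift _ j))).
Let w1 j : 'I_dim := rshift _ (rshift _ (lshift _ j)).
Let w2 j : 'I_dim := rshift _ (rshift _ (rshift _ (lshift _ j))).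
Let w3 j : 'I_dim := rshift _ (rshift _ (rshift _ (rshift _ j))).

(* One summand for each kind of Kronecker block, in the order of the theorem. *)
Let index := ('I_q1 + ('I_n3 * unit + ('I_p2 * option bool
  + ('I_p3 * bool + ('I_q2 * bool + 'I_p1 * (bool * bool))))))%type.

(** Each summand lists positions linked by nonzero entries. For N_3, row x2 meets columns y4
    (constant term) and z2 (lambda term), row z2 meets z2 and x2, and row y4 meets only x2. *)
Let row_pos (k : index) : 'I_dim :=
  match k with
  | inl j => y1 j
  | inr (inl (j, _)) => w3 j
  | inr (inr (inl (j, None))) => x2 j
  | inr (inr (inl (j, Some false))) => z2 j
  | inr (inr (inl (j, Some true))) => y4 j
  | inr (inr (inr (inl (j, false)))) => z3 j
  | inr (inr (inr (inl (j, true)))) => x3 j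
  | inr (inr (inr (inr (inl (j, false))))) => w1 j
  | inr (inr (inr (inr (inl (j, true))))) => y2 j
  | inr (inr (inr (inr (inr (j, (false, false)))))) => x1 j
  | inr (inr (inr (inr (inr (j, (false, true)))))) => y3 j
  | inr (inr (inr (inr (inr (j, (true, false)))))) => z1 j
  | inr (inr (inr (inr (inr (j, (true, true)))))) => w2 j
  end.

(** Within the N_3 and J_2(0) summands the order of [row_pos] is reversed: the reduced pencil is
    symmetric, and the reversal makes these blocks upper triangular. *)
Let col_pos (k : index) : 'I_dim :=
  match k with
  | inl j => y1 j
  | inr (inl (j, _)) => w3 j
  | inr (inr (inl (j, None))) => y4 j
  | inr (inr (inl (j, Some false))) => z2 j
  | inr (inr (inl (j, Some true))) => x2 j
  | inr (inr (inr (inl (j, false)))) => x3 j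
  | inr (inr (inr (inl (j, true)))) => z3 j
  | inr (inr (inr (inr (inl (j, false))))) => y2 j
  | inr (inr (inr (inr (inl (j, true))))) => w1 j
  | inr (inr (inr (inr (inr (j, (false, false)))))) => x1 j
  | inr (inr (inr (inr (inr (j, (false, true)))))) => y3 j
  | inr (inr (inr (inr (inr (j, (true, false)))))) => z1 j
  | inr (inr (inr (inr (inr (j, (true, true)))))) => w2 j
  end.

Let card_index : (#|'I_dim| <= #|{: index}|)%N.
Proof.
rewrite !(card_sum, card_prod, card_ord, card_option, card_bool, card_unit).
by rewrite /dim; lia.
Qed.

Let row_pos_bij : bijective row_pos.
Proof.
apply: inj_card_bij card_index.
case=> [i|[[i []]|[[i [[]|]]|[[i []]|[[i []]|[i [[] []]]]]]]];
case=> [j|[[j []]|[[j [[]|]]|[[j []]|[[j []]|[j [[] []]]]]]]];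
by move=> /eqP; rewrite /= ?eq_shift // => /eqP ->.
Qed.

Let col_pos_bij : bijective col_pos.
Proof.
apply: inj_card_bij card_index.
case=> [i|[[i []]|[[i [[]|]]|[[i []]|[[i []]|[i [[] []]]]]]]];
case=> [j|[[j []]|[[j [[]|]]|[[j []]|[[j []]|[j [[] []]]]]]]];
by move=> /eqP; rewrite /= ?eq_shift // => /eqP ->.
Qed.

Let ord2 (b : bool) : 'I_2 := if b then ord_max else ord0.
Let ord3 (o : option bool) : 'I_3 :=
  if o is Some b then lift ord0 (ord2 b) else ord0.

Let ord1_bij : bijective (fun _ : unit => ord0 : 'I_1).
Proof. by exists (fun=> tt) => [[]|x]; rewrite ?ord1. Qed.

Let ord2_bij : bijective ord2.
Proof.
by apply: inj_card_bij; [case=> [] [] | rewrite card_ord card_bool].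
Qed.

Let ord3_bij : bijective ord3.
Proof.
apply: inj_card_bij; last by rewrite card_ord card_option card_bool.
by case=> [[]|] [[]|].
Qed.

Let reduced_pencil : 'M[{poly R[i]}]_dim :=
  pencil (augmentedA _ (qsvd_formA p2 p3 q1 q2 alpha))
         (augmentedB _ (qsvd_formC p2 q1 q2 n3 gamma)).

Lemma conj_real_diag m (d : 'I_m -> R) :
  map_mx Num.conj (real_diag d) = real_diag d.
Proof.
rewrite /real_diag map_diag_mx; congr diag_mx.
by apply/rowP=> j; rewrite !mxE; apply: conjc_real.
Qed.

(** The form is real, so conjugation disappears and entries can be read through a plain
    transpose. *)
Lemma trmxC_qsvd_formA :
  (qsvd_formA p2 p3 q1 q2 alpha) ^t* = (qsvd_formA p2 p3 q1 q2 alpha)^T.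
Proof.
rewrite -map_trmx; congr trmx.
by rewrite !map_col_mx !map_row_mx !map_mx0 map_mx1 conj_real_diag.
Qed.

Lemma trmxC_qsvd_formC :
  (qsvd_formC p2 q1 q2 n3 gamma) ^t* = (qsvd_formC p2 q1 q2 n3 gamma)^T.
Proof.
rewrite -map_trmx; congr trmx.
by rewrite !map_col_mx !map_row_mx !map_mx0 map_mx1 conj_real_diag.
Qed.

(** The 4 x 4 pencils of the pairs are left undiagonalized here, so that a permutation alone relates
    this to the reduced pencil. *)
Let block_of (k l : index) : {poly R[i]} :=
  fin_sum (fun i j : 'I_q1 => block_pencil (KZero q1 q1) i j)
 (fin_sum (fin_copies (fun (_ : 'I_n3) (_ _ : unit) =>
                         block_pencil (KN 1) ord0 ord0))
 (fin_sum (fin_copies (fun (_ : 'I_p2) i j =>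
                         block_pencil (KN 3) (ord3 i) (ord3 j)))
 (fin_sum (fin_copies (fun (_ : 'I_p3) i j =>
                         block_pencil (KJ 2 0) (ord2 i) (ord2 j)))
 (fin_sum (fin_copies (fun (_ : 'I_q2) i j =>
                         block_pencil (KJ 2 0) (ord2 i) (ord2 j)))
          (fin_copies (fun (k : 'I_p1) i j =>
             (pair_entryA (alpha k)%:C i j)%:P
             - 'X * (pair_entryB (gamma k)%:C i j)%:P)))))) k l.

Let reduced_pencilE (k l : index) :
  block_of k l = reduced_pencil (row_pos k) (col_pos l).
Proof.
rewrite /reduced_pencil /augmentedA /augmentedB trmxC_qsvd_formA
  trmxC_qsvd_formC.
(* These entry rules stop at block boundaries, where [blockE] follows the shifts; a bare [mxE] would
   unfold the blocks into [split]. *)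
have pencilE m n (M N : 'M[R[i]]_(m, n)) i j :
  pencil M N i j = (M i j)%:P - 'X * (N i j)%:P by rewrite !mxE.
have zeroE m n i j : (0 : 'M[R[i]]_(m, n)) i j = 0 by rewrite mxE.
have trE m n (M : 'M[R[i]]_(m, n)) i j : M^T i j = M j i by rewrite mxE.
have oneE m (i j : 'I_m) : (1%:M : 'M[R[i]]_m) i j = (i == j)%:R
  by rewrite mxE.
have diagE m d (i j : 'I_m) : real_diag d i j = (d i)%:C *+ (i == j)
  by rewrite !mxE.
have addE m n (M N : 'M[R[i]]_(m, n)) i j : (M + N) i j = M i j + N i j
  by rewrite mxE.
have scalE m a i j : (a%:M : 'M[R[i]]_m) i j = a *+ (i == j) by rewrite mxE.
have superE m (i j : 'I_m) :
  superdiag_mx R[i] m m i j = (j == i.+1 :> nat)%:R by rewrite mxE.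
pose blockE := (block_mxEul, block_mxEur, block_mxEdl, block_mxEdr,
  col_mxEu, col_mxEd, row_mxEl, row_mxEr).
move: k l.
case=> [i|[[i []]|[[i [[]|]]|[[i []]|[[i []]|[i [[] []]]]]]]];
case=> [j|[[j []]|[[j [[]|]]|[[j []]|[[j []]|[j [[] []]]]]]]].
all: rewrite /block_of /fin_sum /fin_copies /= ?pencilE.
all: rewrite ?blockE.
all: rewrite ?zeroE ?trE.
all: rewrite /qsvd_formA /qsvd_formC ?blockE.
all: rewrite ?zeroE ?oneE ?diagE.
all: rewrite ?eq_shift.
all: rewrite /= ?mulr1n ?mulr0n ?polyC0 ?polyC1 ?mulr0 ?subr0 ?mul0rn //.
1: by rewrite mxE.
all: rewrite ?addE ?superE ?scalE /=.
(* Equal indices give the entries of one block; different indices belong to different copies, where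
   both sides vanish. *)
all: have [ij|_] := eqVneq i j; rewrite ?ij ?mulr1n ?mulr0n.
all: ring.
Qed.

Lemma reduced_pencil_equiv :
    (forall j, 0 < alpha j) -> (forall j, 0 < gamma j) ->
  let root j : R[i] := (Num.sqrt (quotient_sv alpha gamma j))%:C in
  pencil_equiv
    (pencil (augmentedA _ (qsvd_formA p2 p3 q1 q2 alpha))
            (augmentedB _ (qsvd_formC p2 q1 q2 n3 gamma)))
    (kron_diag (KZero q1 q1
     :: nseq n3 (KN 1)
     ++ nseq p2 (KN 3)
     ++ nseq (p3 + q2) (KJ 2 0)
     ++ flatten [seq [:: KJ 1 (root j); KJ 1 (- root j);
                         KJ 1 ('i * root j); KJ 1 (- ('i * root j))]
                | j <- enum 'I_p1])).
Proof.
move=> alpha_gt0 gamma_gt0 root; apply: has_kcf_of_mx.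
apply: (has_kcf_bij row_pos_bij col_pos_bij reduced_pencilE).
have copies1 m (I : finType) (P : I -> I -> {poly R[i]}) b :
    has_kcf P [:: b] -> has_kcf (fin_copies (fun _ : 'I_m => P)) (nseq m b).
  move=> Pb; have := @has_kcf_copies _ m _ _ _ (fun=> [:: b]) (fun=> Pb).
  rewrite flatten_map1; congr has_kcf.
  by rewrite -[m in nseq m]size_enum_ord; elim: (enum _) => //= _ e ->.
have idB m : bijective (@id 'I_m) by exists id.
(* The blocks J_2(0) come from two families of positions, of sizes [p3] and [q2]. *)
rewrite nseqD -catA -cat1s.
apply: has_kcf_sum.
  exact: has_kcf_mx (idB _) (idB _) (block_pencil_equiv _).
apply: has_kcf_sum.
  exact/copies1/(has_kcf_mx ord1_bij ord1_bij)/(block_pencil_equiv (KN 1)).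
apply: has_kcf_sum.
  exact/copies1/(has_kcf_mx ord3_bij ord3_bij)/(block_pencil_equiv (KN 3)).
apply: has_kcf_sum.
  exact/copies1/(has_kcf_mx ord2_bij ord2_bij)/(block_pencil_equiv (KJ 2 0)).
apply: has_kcf_sum.
  exact/copies1/(has_kcf_mx ord2_bij ord2_bij)/(block_pencil_equiv (KJ 2 0)).
apply: has_kcf_copies => j; have sv_gt0 := divr_gt0 (alpha_gt0 j) (gamma_gt0 j).
have C_eq0 (x : R) : (x%:C == 0) = (x == 0) by rewrite fmorph_eq0.
apply: has_kcf_pair.
- by rewrite pnatr_eq0.
- by rewrite C_eq0 gt_eqF.
- by rewrite C_eq0 sqrtr_eq0 -ltNge.
- by rewrite -rmorphXn /= sqr_sqrtr ?ltW // fmorph_div.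
- exact: sqr_i.
Qed.

End ReducedPencil.

(** * From equivalence to the Kronecker canonical form *)

Section TrmxC.

Variable K : numClosedFieldType.

Local Open Scope sesquilinear_scope.

Lemma trmxC_mul m n k (M : 'M[K]_(m, n)) (N : 'M[K]_(n, k)) :
  (M *m N) ^t* = N ^t* *m M ^t*.
Proof. by rewrite trmx_mul map_mxM. Qed.

Lemma trmxC_mul3 m n k l (M : 'M[K]_(n, m)) (N : 'M[K]_(n, k))
    (P : 'M[K]_(k, l)) :
  (M ^t* *m N *m P) ^t* = P ^t* *m N ^t* *m M.
Proof. by rewrite !trmxC_mul trmxCK mulmxA. Qed.

(** Two-sided inverses bound each size by the other, so the transformations are square. The left one
    is passed as [Y ^t*] because the definition conjugates and transposes it again. *)
Lemma KCF_of_pencil_equiv k l (P : 'M[{poly K}]_(k, l)) s :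
  pencil_equiv P (kron_diag s) -> KCF_consists_of P s.
Proof.
move=> [Y [Y' [X [X' [[YY' Y'Y] [XX' X'X] E]]]]].
have ek : kron_rows s = k.
  by apply/anti_leq; rewrite (mulmx1_min YY') (mulmx1_min Y'Y).
have el : kron_cols s = l.
  by apply/anti_leq; rewrite (mulmx1_min XX') (mulmx1_min X'X).
exists ek, el; move: Y Y' X X' YY' Y'Y XX' X'X E; move: (kron_diag s).
case: k / ek P; case: l / el => P D Y Y' X X' YY' _ XX' _ <-.
exists X, (Y ^t*); rewrite castmx_id trmxCK; split=> //.
- by have [] := mulmx1_unit XX'.
- by rewrite map_unitmx unitmx_tr; have [] := mulmx1_unit YY'.
Qed.

End TrmxC.

(** * Reduction of the augmented pencil to the QSVD forms *)

Section Augmented.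

Variable R : realType.

Local Open Scope sesquilinear_scope.

(** The identity blocks only meet the unitary factors [U] and [V], and so survive. The factor [Y]
    only meets A, C and their adjoints, so nonsingularity is enough for it. *)
Lemma augmented_pencil_equiv p q n (A A' : 'M[R[i]]_(p, q))
    (C C' : 'M[R[i]]_(n, q)) (U : 'M[R[i]]_p) (V : 'M[R[i]]_n)
    (Y : 'M[R[i]]_q) :
    U \is unitarymx -> V \is unitarymx -> Y \in unitmx ->
    U ^t* *m A *m Y = A' -> V ^t* *m C *m Y = C' ->
  pencil_equiv (pencil (augmentedA n A) (augmentedB p C))
               (pencil (augmentedA n A') (augmentedB p C')).
Proof.
move=> /unitarymxP UU' /unitarymxP VV' Yu <- <-.
have U'U := mulmx1C UU'; have V'V := mulmx1C VV'.
have YY' := mulmxV Yu; have Y'Y := mulVmx Yu.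
have YtY' : Y ^t* *m (invmx Y) ^t* = 1%:M.
  by rewrite -trmxC_mul Y'Y trmx1 map_mx1.
have Y'tY := mulmx1C YtY'.
pose D (P : 'M[R[i]]_p) (Q : 'M[R[i]]_q) (S : 'M[R[i]]_n) :=
  block_mx (block_mx P 0 0 Q) 0 0 (block_mx P 0 0 S).
exists (D (U ^t*) (Y ^t*) (V ^t*)), (D U ((invmx Y) ^t*) V).
exists (D U Y V), (D (U ^t*) (invmx Y) (V ^t*)).
have DM P Q S P' Q' S' : P *m P' = 1%:M -> Q *m Q' = 1%:M -> S *m S' = 1%:M ->
    D P Q S *m D P' Q' S' = 1%:M.
  move=> PP' QQ' SS'; rewrite /D !mulmx_block !(mulmx0, mul0mx, addr0, add0r).
  by rewrite PP' QQ' SS' -!scalar_mx_block.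
split; [by split; apply: DM | by split; apply: DM |].
rewrite mulmx_pencil /D /augmentedA /augmentedB.
(* One pass for the outer 2 x 2 partition, one for the inner. *)
do 2!rewrite !mulmx_block !(mulmx0, mul0mx, addr0, add0r).
by rewrite !mulmx1 U'U V'V (trmxC_mul3 U) (trmxC_mul3 V).
Qed.

End Augmented.

Theorem theorem4p3 (R : realType) (p q n : nat)
    (A : 'M[R[i]]_(p, q)) (C : 'M[R[i]]_(n, q))
    (p1 p2 p3 q1 q2 n3 : nat) (alpha gamma : 'I_p1 -> R)
    (U : 'M[R[i]]_p) (V : 'M[R[i]]_n) (Y : 'M[R[i]]_q)
    (hQSVD : is_qsvd A C p2 p3 q1 q2 n3 alpha gamma U V Y) :
  let root j : R[i] := (Num.sqrt (quotient_sv alpha gamma j))%:C in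
  KCF_consists_of (pencil (augmentedA n A) (augmentedB p C))
    (KZero q1 q1
     :: nseq n3 (KN 1)
     ++ nseq p2 (KN 3)
     ++ nseq (p3 + q2) (KJ 2 0)
     ++ flatten [seq [:: KJ 1 (root j); KJ 1 (- root j);
                         KJ 1 ('i * root j); KJ 1 (- ('i * root j))]
                | j <- enum 'I_p1]).
Proof.
case: hQSVD => ep eq en Uu Vu Yu alpha_gt0 gamma_gt0 _.
(* Identifying the sizes with their block sums removes the casts from the QSVD forms. *)
subst p q n; rewrite !castmx_id => UAY VCY root.
apply/KCF_of_pencil_equiv/pencil_equiv_trans/reduced_pencil_equiv => //.
exact: (augmented_pencil_equiv Uu Vu Yu UAY VCY).
Qed.
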